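(* Let $g_0, g_1,\ldots,g_m:\mathbb{R}^n\to\mathbb{R}$ be polynomials, let $p_i:=\deg(g_i)$, and let $\phi_{i,p_i}$ denote the homogeneous component of $g_i$ of degree $p_i$, for $i\in\{0,1,\ldots,m\}$. Let $$\mathcal{D}^\star := \{ d \in \mathbb{S}^{n-1} : (g_i)_\infty(d) < 0 \ \text{ for all } i \in \{0,1,\ldots,m\}\}$$ be nonempty. If there exists $d_0 \in \mathcal{D}^\star$ such that $\phi_{i,p_i}(d_0) < 0$ for all $i \in \{0,1,\ldots,m\}$, then $\sigma(\mathcal{D}^\star)>0$.
   Context: Here $g_0=f$ plays the role of the objective and $g_1,\ldots,g_m$ of the constraints of the problem $\inf\{f(x): g_i(x)\le 0,\ i=1,\ldots,m\}$. $\mathbb{S}^{n-1}$ is the Euclidean unit sphere in $\mathbb{R}^n$, and $\sigma$ is the normalized surface measure on it: $\sigma(A)=\mathcal{H}^{n-1}(A)/\mathcal{H}^{n-1}(\mathbb{S}^{n-1})$, where $\mathcal{H}^{n-1}$ is $(n-1)$-dimensional Hausdorff measure. For a polynomial $h:\mathbb{R}^n\to\mathbb{R}$, write its unique decomposition $h=\sum_{k=0}^{p}\phi_k$ with each $\phi_k$ a homogeneous polynomial of degree $k$ (possibly zero). For $d\in\mathbb{R}^n\setminus\{0\}$ let $\mu(d):=\max\{k:\phi_k(d)\neq 0\}$. The asymptotic value $h_\infty(d)\in[-\infty,+\infty]$ is: $h_\infty(d)=-\infty$ if $\mu(d)\ge 2$ and $\phi_{\mu(d)}(d)<0$; $h_\infty(d)=+\infty$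 if $\mu(d)\ge 2$ and $\phi_{\mu(d)}(d)>0$; $h_\infty(d)=\phi_1(d)$ if $\mu(d)=1$; and $h_\infty(d)=0$ if $\phi_k(d)=0$ for all $k\ge 1$. Equivalently, $h_\infty(d)=\lim_{t\to\infty} h(td)/t$. *)

(* Defs.v *)
From mathcomp Require Import all_boot all_order all_algebra.
From mathcomp Require Import all_classical all_reals all_analysis.
(* The notations of [mpoly] clash with those of MathComp-Analysis;
   [mpoly.mpoly n R] is the type {mpoly R[n]}. *)
From mathcomp Require Import (canonicals, coercions) mpoly.

Set Implicit Arguments.
Unset Strict Implicit.
Unset Printing Implicit Defensive.

Import Order.TTheory GRing.Theory Num.Theory.

Local Open Scope classical_set_scope.
Local Open Scope ring_scope.

Definition mp_degree (n : nat) (R : realType) (h : mpoly.mpoly n R) : nat :=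
  (mpoly.msize h).-1.

Definition mp_hcomp (n : nat) (R : realType) (k : nat) (h : mpoly.mpoly n R)
    : mpoly.mpoly n R :=
  mpoly.pihomog (@mpoly.mdeg n) k h.

Definition mp_eval (n : nat) (R : realType) (h : mpoly.mpoly n R)
    (d : 'rV[R]_n) : R :=
  mpoly.meval (fun i => d ord0 i) h.

(* mu(d). The maximum over the empty set is 0, so this is 0 exactly when every
   component of degree k >= 1 vanishes at d. *)
Definition asymptotic_index (n : nat) (R : realType) (h : mpoly.mpoly n R)
    (d : 'rV[R]_n) : nat :=
  (\max_(k < mpoly.msize h | (mp_eval (mp_hcomp k h) d != 0)%R) k)%N.

(* When mu(d) >= 2 the component of degree mu(d) does not vanish at d, so the
   +oo branch is the case where it is positive. *)
Definition asymptotic_value (n : nat) (R : realType) (h : mpoly.mpoly n R)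
    (d : 'rV[R]_n) : \bar R :=
  let mu := asymptotic_index h d in
  let v := mp_eval (mp_hcomp mu h) d in
  if (2 <= mu)%N then (if v < 0 then -oo%E else +oo%E)
  else if mu == 1%N then v%:E else 0%E.

(* The norm `|x| of the library on 'rV[R]_n is the sup norm. *)
Definition euclidean_norm (n : nat) (R : realType) (x : 'rV[R]_n) : R :=
  Num.sqrt (\sum_(i < n) x ord0 i ^+ 2).

Definition unit_sphere (n : nat) (R : realType) : set 'rV[R]_n :=
  [set x | euclidean_norm x = 1].
Arguments unit_sphere n R : clear implicits.

(* Equal to -oo on the empty set. *)
Definition diameter (n : nat) (R : realType) (U : set 'rV[R]_n) : \bar R :=
  ereal_sup [set r | exists x y,
    [/\ U x, U y & r = (euclidean_norm (x - y))%:E]].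

(* diam(U)^s, with value 0 on the empty set, also for s = 0. *)
Definition diameter_pow (n : nat) (R : realType) (s : nat) (U : set 'rV[R]_n)
    : \bar R :=
  if U == set0 then 0%E else (diameter U ^+ s)%E.

Definition hausdorff_content (n : nat) (R : realType) (s : nat) (delta : R)
    (A : set 'rV[R]_n) : \bar R :=
  ereal_inf [set r | exists U : nat -> set 'rV[R]_n,
    [/\ A `<=` \bigcup_i U i,
        forall i, (diameter (U i) <= delta%:E)%E
      & r = (\sum_(0 <= i <oo) diameter_pow s (U i))%E]].

(* The s-dimensional Hausdorff (outer) measure on R^n, s a natural number,
   without the constant factor vol(B^s) / 2^s; this factor cancels in
   [sphere_measure]. *)
Definition hausdorff_measure (n : nat) (R : realType) (s : nat)
    (A : set 'rV[R]_n) : \bar R :=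
  ereal_sup [set hausdorff_content s delta A | delta in [set delta | 0 < delta]].

Definition sphere_measure (n : nat) (R : realType) (A : set 'rV[R]_n) : \bar R :=
  (hausdorff_measure n.-1 A / hausdorff_measure n.-1 (unit_sphere n R))%E.

Definition Dstar (n m : nat) (R : realType) (g : 'I_m.+1 -> mpoly.mpoly n R)
    : set 'rV[R]_n :=
  [set d | unit_sphere n R d /\ forall i, (asymptotic_value (g i) d < 0)%E].

(* Main.v *)
Require Import Defs.
From mathcomp Require Import all_boot all_order all_algebra.
From mathcomp Require Import finmap.
From mathcomp Require Import all_classical all_reals all_analysis.
From mathcomp Require Import (canonicals, coercions) mpoly.
From mathcomp Require Import ring lra.

(** The asymptotic value of each [g i] at [d0] is negative, so [g i] has positive
    degree, and negativity of its leading form at a direction [d] then forces the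
    asymptotic value at [d] to be negative ([asymptotic_value_lt0]).  Leading
    forms are continuous, so the direction set contains a neighbourhood of [d0]
    in the sphere ([near_Dstar]).  It remains to compare Hausdorff measures of
    dimension [s], one less than the dimension of the ambient space: the
    normalized measure is positive as soon as a relatively open piece of the
    sphere has positive measure and the whole sphere has finite measure.

    Positivity.  Some coordinate of [d0] is nonzero; near [d0] the sphere is a
    graph over the remaining [s] coordinates ([sphere_chart]), so the projection
    of the direction set to these coordinates contains a cube.  Projecting does
    not increase distances, hence a cover of the direction set by sets of
    diameter [r_i] yields a cover of the cube by cubes of half-side [r_i], up to
    an arbitrarily small enlargement which makes them open.  By compactness
    finitely many suffice, and a finite family of cubes covering a cube has at
    least its total volume ([cube_cover_volume], by counting grid points).  This
    is [hausdorff_measure_proj_ge].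

    Finiteness.  Every point of the sphere has a coordinate of absolute value at
    least [1 / s.+1]; where a given coordinate is that large with a given sign,
    the sphere is a Lipschitz graph over the others
    ([unit_sphere_graph_lipschitz]).  Pulling back a grid of mesh [1 / N] covers
    the sphere with [O(N ^ s)] sets of diameter [O(1 / N)]
    ([hausdorff_measure_sphere_lty]). *)

Set Implicit Arguments.
Unset Strict Implicit.
Unset Printing Implicit Defensive.

Import Order.TTheory GRing.Theory Num.Theory.
Import numFieldNormedType.Exports.

Local Open Scope classical_set_scope.
Local Open Scope ring_scope.

(** * Finite covers of a cube by cubes *)

Lemma card_ord_itv_le (R : realType) (M : nat) (lo len : R) : 0 <= len ->
  #|[pred j : 'I_M | lo <= j%:R <= lo + len]|%:R <= len + 1.
Proof.
move=> len0; set A := [pred j | _].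
have [j0 Aj0|A0] := pickP A; last by rewrite eq_card0// addr_ge0.
case: (arg_minnP (fun j : 'I_M => j : nat) Aj0) => a Aa amin.
case: (arg_maxnP (fun j : 'I_M => j : nat) Aj0) => b Ab bmax.
have {}bmax (j : 'I_M) : A j -> (j <= b)%N by exact: bmax.
have leab : (a <= b)%N by apply: amin.
pose shift (j : 'I_M) : 'I_(b - a).+1 := inord (j - a).
have /leq_trans cardA : (#|A| <= #|image_mem shift (mem A)|)%N.
  rewrite card_in_image// => j k Aj Ak /(congr1 val) /=.
  rewrite !inordK ?ltnS ?leq_sub2r ?bmax// => /eqP.
  by rewrite eqn_sub2rE ?amin// => /eqP /val_inj.
have {}cardA : (#|A| <= (b - a).+1)%N.
  by apply: cardA; rewrite (leq_trans (max_card _))// card_ord.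
rewrite (@le_trans _ _ (b - a).+1%:R) ?ler_nat//.
rewrite -natr1 lerD2r natrB//.
by have /andP[? _] := Aa; have /andP[_ ?] := Ab; lra.
Qed.

(** Each of the [M ^ s] grid points of the big cube lies in a small one, while a
    cube of half-side [r i] contains at most [(r i * M / h + 1) ^ s] of them, one
    factor per coordinate.  The summand [h / M] is the discretization error. *)
Lemma grid_cover_volume (R : realType) (s : nat) (I : finType)
    (P : pred I) (a : 'I_s -> R) (h : R)
    (c : I -> 'I_s -> R) (r : I -> R) (M : nat) :
  0 < h -> (0 < M)%N -> (forall i, P i -> 0 <= r i) ->
  (forall y : 'I_s -> R, (forall k, `|y k - a k| <= h) ->
    exists2 i, P i & forall k, `|y k - c i k| <= r i) ->
  h ^+ s <= \sum_(i | P i) (r i + h / M%:R) ^+ s.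
Proof.
move=> h0 M0 r0 cover.
have MR0 : 0 < M%:R :> R by rewrite ltr0n.
(* The lower corners of the [M ^ s] cells into which the cube is divided. *)
pose y (f : {ffun 'I_s -> 'I_M}) k := a k - h + 2 * h / M%:R * (f k)%:R.
pose hit i := [pred f | [forall k, `|y f k - c i k| <= r i]].
have yin f : exists2 i, P i & f \in hit i.
  have [|i Pi yi] := cover (y f); last by exists i => //; apply/forallP.
  move=> k; have fM : (f k)%:R / M%:R <= 1 :> R.
    by rewrite ler_pdivrMr// mul1r ler_nat ltnW.
  have fM0 : 0 <= (f k)%:R / M%:R :> R by rewrite divr_ge0.
  rewrite ler_norml /y; move: fM fM0; set q := _ / _ => q1 q0.
  have -> : 2 * h / M%:R * (f k)%:R = 2 * h * q by rewrite /q; ring.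
  by apply/andP; split; nra.
have step i : P i -> #|hit i|%:R <= (r i * M%:R / h + 1) ^+ s.
  move=> /r0 ri0.
  pose A k := [pred j : 'I_M | (c i k - r i - a k + h) * M%:R / (2 * h) <= j%:R
     <= (c i k - r i - a k + h) * M%:R / (2 * h) + r i * M%:R / h].
  rewrite (@le_trans _ _ (\prod_k #|A k|)%:R)//.
    rewrite ler_nat -big_enum.
    rewrite -[X in (_ <= X)%N](big_map (fun k => #|A k|) xpredT id).
    rewrite -foldrE -card_family; apply/subset_leq_card/fintype.subsetP => f.
    move=> /forallP fi; apply/familyP => k; have := fi k.
    rewrite ler_norml /y inE => /andP[fl fu].
    set q := (2 * h / M%:R) in fl fu.
    have q0 : 0 < q by rewrite divr_gt0// mulr_gt0.
    have -> : (c i k - r i - a k + h) * M%:R / (2 * h) =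
        (c i k - r i - a k + h) / q.
      by rewrite /q; field; rewrite !gt_eqF.
    have -> : r i * M%:R / h = (2 * r i) / q.
      by rewrite /q; field; rewrite !gt_eqF.
    by rewrite -mulrDl ler_pdivrMr// ler_pdivlMr//; apply/andP; split; lra.
  rewrite natr_prod -[in leRHS](card_ord s) -prodr_const ler_prod// => k _.
  by rewrite ler0n card_ord_itv_le// !mulr_ge0 ?invr_ge0// ltW.
have total : (M ^ s)%N%:R <= \sum_(i | P i) (#|hit i|%:R : R).
  rewrite -natr_sum ler_nat -{1}(card_ord M) -{1}(card_ord s) -card_ffun.
  rewrite -sum1_card; under [leqRHS]eq_bigr do rewrite -sum1_card big_mkcond.
  rewrite exchange_big /=; apply: leq_sum => f _.
  have [i Pi fi] := yin f; rewrite (bigD1 i)//=.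
  by move: fi; rewrite unfold_in /= => ->.
have := le_trans total (ler_sum _ (fun i Pi => step i Pi)).
rewrite natrX => /(ler_wpM2l (exprn_ge0 s (ltW (divr_gt0 h0 MR0)))).
rewrite -exprMn divfK ?gt_eqF// mulr_sumr => /le_trans; apply.
apply: ler_sum => i _; rewrite -exprMn le_eqVlt; apply/orP; left; apply/eqP.
by congr (_ ^+ _); field; rewrite !gt_eqF.
Qed.

(** The discretization error of the grid bound vanishes as the mesh is refined. *)
Lemma cube_cover_volume (R : realType) (s : nat) (I : finType)
    (P : pred I) (a : 'I_s -> R) (h : R)
    (c : I -> 'I_s -> R) (r : I -> R) :
  0 < h -> (forall i, P i -> 0 <= r i) ->
  (forall y : 'I_s -> R, (forall k, `|y k - a k| <= h) ->
    exists2 i, P i & forall k, `|y k - c i k| <= r i) ->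
  h ^+ s <= \sum_(i | P i) r i ^+ s.
Proof.
move=> h0 r0 cover.
pose p : {poly R} := \sum_(i | P i) ((r i)%:P + 'X) ^+ s.
have pE x : p.[x] = \sum_(i | P i) (r i + x) ^+ s.
  by rewrite /p horner_sum; apply: eq_bigr => i _; rewrite !hornerE.
have lim : p.[h * harmonic M] @[M --> \oo] --> p.[h * 0].
  apply: continuous_cvg; first exact: continuous_horner.
  by apply: cvgM; [exact: cvg_cst|exact: cvg_harmonic].
have -> : \sum_(i | P i) r i ^+ s = p.[h * 0].
  by rewrite pE; apply: eq_bigr => i _; rewrite mulr0 addr0.
rewrite -(cvg_lim _ lim)//.
apply: limr_ge; first by apply/cvg_ex; exists p.[h * 0].
by near=> M; rewrite pE; apply: grid_cover_volume cover.
Unshelve. all: by end_near. Qed.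

(** * Lower bounds for Hausdorff measures from coordinate projections *)

(** Lets the members of a cover be enlarged to open sets at a small cost. *)
Lemma exprn_perturb (R : realType) (s : nat) (r eta : R) : 0 < eta ->
  exists2 e, 0 < e & (r + e) ^+ s <= r ^+ s + eta.
Proof.
move=> eta0.
have /cvgrPdist_lt/(_ _ eta0)/nbhs_ballP[e /= e0 near_r] :=
  @exprn_continuous R s r.
exists (e / 2); first by rewrite divr_gt0.
have /near_r : ball r e (r + e / 2).
  rewrite -ball_normE /= opprD addrA subrr add0r normrN gtr0_norm ?divr_gt0//.
  by lra.
by rewrite /= ltr_norml => /andP[? _]; lra.
Qed.

Lemma normr_le_euclidean_norm (R : realType) (n : nat) (x : 'rV[R]_n) k :
  `|x ord0 k| <= euclidean_norm x.
Proof.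
rewrite -sqrtr_sqr; apply: ler_wsqrtr.
by rewrite (bigD1 k)//= lerDl sumr_ge0// => i _; rewrite sqr_ge0.
Qed.

(** Nonemptiness matters: the empty set has diameter [-oo]. *)
Lemma diameter_fin (R : realType) (n : nat) (U : set 'rV[R]_n) (delta : R) :
  U !=set0 -> (diameter U <= delta%:E)%E ->
  exists r, [/\ 0 <= r, diameter U = r%:E
    & forall x y, U x -> U y -> euclidean_norm (x - y) <= r].
Proof.
move=> [u Uu] Udelta.
have diamU x y : U x -> U y -> ((euclidean_norm (x - y))%:E <= diameter U)%E.
  by move=> Ux Uy; apply: ereal_sup_ubound; exists x, y.
have diam0 : (0 <= diameter U)%E.
  by apply: le_trans (diamU u u Uu Uu); rewrite lee_fin sqrtr_ge0.
have diamE : diameter U = (fine (diameter U))%:E.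
  by rewrite fineK// ge0_fin_numE// (le_lt_trans Udelta)// ltry.
exists (fine (diameter U)); split; rewrite ?fine_ge0// => x y Ux Uy.
by rewrite -lee_fin -diamE diamU.
Qed.

Lemma diameter_pow_ge0 (R : realType) (n s : nat) (U : set 'rV[R]_n) :
  (0 <= diameter_pow s U)%E.
Proof.
rewrite /diameter_pow; case: ifPn => // /set0P[u Uu]; apply: expe_ge0.
apply: le_ereal_sup_tmp.
exists (euclidean_norm (u - u))%:E; first by exists u, u.
by rewrite lee_fin sqrtr_ge0.
Qed.

(** A coordinate projection is 1-Lipschitz, so it maps a cover of [A] to a cover
    of the cube without increasing diameters; the volume bound for finite covers
    of a cube then applies after a compactness argument. *)
Lemma hausdorff_measure_proj_ge (R : realType) (s n : nat) (A : set 'rV[R]_n)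
    (p : 'I_s -> 'I_n) (a : 'I_s -> R) (h : R) :
  0 < h ->
  (forall y : 'rV[R]_s, (forall k, `|y ord0 k - a k| <= h) ->
    exists2 x, A x & forall k, x ord0 (p k) = y ord0 k) ->
  ((h ^+ s)%:E <= hausdorff_measure s A)%E.
Proof.
move=> h0 lift; apply: le_ereal_sup_tmp.
exists (hausdorff_content s 1 A); first by exists 1 => //=.
apply: le_ereal_inf_tmp => _ [U [coverU diamU ->]].
apply/lee_addgt0Pr => e e0.
pose proj (x : 'rV[R]_n) : 'rV[R]_s := \row_k x ord0 (p k).
have /choice[c] : forall i, exists c : 'rV[R]_s * R, U i !=set0 ->
    [/\ 0 <= c.2, forall x, U i x -> ball c.1 c.2 (proj x)
      & ((c.2 ^+ s)%:E <= diameter_pow s (U i) + (e / (2 ^ i.+1)%:R)%:E)%E].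
  (* The cost [e / 2 ^ i.+1] of enlarging the [i]-th set sums to [e]. *)
  move=> i; have [[u Uu]|/nonemptyPn Ui0] := pselect (U i !=set0); last first.
    by exists (0, 0); rewrite Ui0 => /set0P; rewrite eqxx.
  have Ui0 : U i !=set0 by exists u.
  have [r [r0 diamE Ur]] := diameter_fin Ui0 (diamU i).
  have eta0 : 0 < e / (2 ^ i.+1)%:R by rewrite divr_gt0// ltr0n expn_gt0.
  have [e' e'0 le_e'] := exprn_perturb s r eta0.
  exists (proj u, r + e') => _; split => /=.
  - by rewrite addr_ge0// ltW.
  - move=> x Ux; split; first by rewrite ltr_wpDl.
    move=> i0 k; rewrite -ball_normE /= !mxE.
    have := Ur _ _ Uu Ux; have := normr_le_euclidean_norm (u - x) (p k).
    by rewrite !mxE; lra.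
  - rewrite /diameter_pow ifN; last exact/set0P.
    by rewrite diamE -EFin_expe -EFinD lee_fin.
move=> cP.
pose Q := [set y : 'rV[R]_s | forall k, `[a k - h, a k + h]%classic (y ord0 k)].
have compactQ : compact Q.
  apply: (@rV_compact _ s (fun k => `[a k - h, a k + h]%classic)) => k.
  exact: segment_compact.
have [D DU coverD] : finite_subset_cover [set i | U i !=set0]
    (fun i => ball (c i).1 (c i).2) Q.
  move: compactQ; rewrite compact_cover => coverQ; apply: coverQ => [i _|y Qy].
    exact: ball_open.
  have [|x Ax xy] := lift y.
    by move=> k; have := Qy k; rewrite /= in_itv/= ler_distl.
  have [i _ Uix] := coverU x Ax; have Ui0 : U i !=set0 by exists x.
  exists i => //; have [_ /(_ x Uix) + _] := cP i Ui0.
  by congr ball; apply/rowP => k; rewrite mxE xy.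
(* The series is compared with its partial sum up to the last selected index. *)
pose N := (\max_(i <- D) i).+1.
have le_N (i : nat) : i \in D -> (i < N)%N by move=> iD; exact: leq_bigmax_seq.
have vol : h ^+ s <= \sum_(i < N | (i : nat) \in D) (c i).2 ^+ s.
  apply: (@cube_cover_volume R s _ _ a h (fun i k => (c (i : 'I_N)).1 ord0 k)).
  - by [].
  - by move=> i iD; have /DU := iD; rewrite inE => /cP[].
  - move=> y ya; have [i /= iD [_ yi]] :
        cover [set` D] (fun i => ball (c i).1 (c i).2) (\row_k y k).
      by apply: coverD => k /=; rewrite mxE in_itv/= -ler_distl.
    exists (Ordinal (le_N i iD)) => //= k.
    have := yi ord0 k; rewrite -ball_normE /= mxE distrC; exact: ltW.
have U0 i := diameter_pow_ge0 s (U i).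
apply: le_trans (epsilon_trick xpredT U0 (ltW e0)).
apply: le_trans (nneseries_lim_ge N _); last first.
  by move=> i _ _; rewrite adde_ge0// lee_fin divr_ge0// ltW.
rewrite big_mkord (bigID (fun i : 'I_N => (i : nat) \in D))/=.
have -> : (h ^+ s)%:E = ((h ^+ s)%:E + 0)%E by rewrite adde0.
apply: leeD; last first.
  by apply: sume_ge0 => i _; rewrite adde_ge0// lee_fin divr_ge0// ltW.
apply: (@le_trans _ _ (\sum_(i < N | (i : nat) \in D) (c i).2 ^+ s)%:E) => //.
rewrite -sumEFin.
by apply: lee_sum => i /DU; rewrite inE => /cP[].
Qed.

(** * Finiteness of the Hausdorff measure of the sphere *)

Lemma hausdorff_content_finite_cover (R : realType) (s n : nat) (T : finType)
    (U : T -> set 'rV[R]_n) (A : set 'rV[R]_n) (r delta : R) :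
  A `<=` \bigcup_t U t -> 0 <= r -> r <= delta ->
  (forall t, (diameter (U t) <= r%:E)%E) ->
  (hausdorff_content s delta A <= (#|T|%:R * r ^+ s)%:E)%E.
Proof.
move=> coverA r0 rdelta diamU.
pose V i := if insub i is Some j then U (enum_val (j : 'I_#|T|)) else set0.
have VE (i : 'I_#|T|) : V i = U (enum_val i) by rewrite /V valK.
have V0 i : (#|T| <= i)%N -> V i = set0.
  by move=> Ti; rewrite /V insubF// ltnNge Ti.
apply: le_trans (_ : (\sum_(0 <= i <oo) diameter_pow s (V i) <= _)%E).
  apply: ereal_inf_lbound; exists V; split => //.
    move=> x /coverA[t _ Ux]; exists (enum_rank t) => //.
    by rewrite VE enum_rankK.
  move=> i; have [iT|Ti] := ltnP i #|T|.
    by rewrite (VE (Ordinal iT)) (le_trans (diamU _))// lee_fin.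
  rewrite V0//; apply: ge_ereal_sup => d [x [y []]].
  by [].
rewrite (nneseries_split 0 #|T|); last by move=> k _; exact: diameter_pow_ge0.
rewrite add0n eseries0 ?adde0; last first.
  by move=> i Ti _; rewrite V0// /diameter_pow eqxx.
rewrite big_mkord mulr_natl -[in leRHS](card_ord #|T|) -sumr_const -sumEFin.
apply: lee_sum => i _; rewrite VE /diameter_pow.
case: ifPn => [_|/set0P U0]; first by rewrite lee_fin exprn_ge0.
have [d [d0 dE _]] := diameter_fin U0 (diamU (enum_val i)).
rewrite dE -EFin_expe lee_fin lerXn2r ?nnegrE//.
by have := diamU (enum_val i); rewrite dE lee_fin.
Qed.

Lemma euclidean_norm_le_coord (R : realType) (n : nat) (x : 'rV[R]_n) (r : R) :
  (forall k, `|x ord0 k| <= r) -> euclidean_norm x <= n%:R * r.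
Proof.
case: n x => [x _|n x xr].
  by rewrite /euclidean_norm big_ord0 sqrtr0 mul0r.
have r0 : 0 <= r by apply: le_trans (xr ord0).
have nr0 : 0 <= n.+1%:R * r by rewrite mulr_ge0.
rewrite -[leRHS]ger0_norm// -sqrtr_sqr; apply: ler_wsqrtr.
rewrite (@le_trans _ _ (\sum_(k < n.+1) r ^+ 2))//.
  by apply: ler_sum => k _; rewrite -real_normK ?num_real// lerXn2r ?nnegrE.
rewrite sumr_const card_ord -[leLHS]mulr_natl exprMn ler_wpM2r ?sqr_ge0//.
by rewrite -natrX ler_nat leq_pmulr.
Qed.

Lemma unit_sphere_sumsq (R : realType) (n : nat) (x : 'rV[R]_n) :
  unit_sphere n R x <-> \sum_k x ord0 k ^+ 2 = 1.
Proof.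
rewrite /unit_sphere /euclidean_norm /=; split => [x1|->]; last exact: sqrtr1.
by rewrite -[LHS]sqr_sqrtr ?x1 ?expr1n// sumr_ge0// => k _; rewrite sqr_ge0.
Qed.

Lemma unit_sphere_large_coord (R : realType) (n : nat) (x : 'rV[R]_n) :
  unit_sphere n R x -> exists j, n%:R^-1 <= `|x ord0 j|.
Proof.
move=> /unit_sphere_sumsq x1.
case: n x x1 => [x|n x x1].
  by rewrite big_ord0 => /eqP; rewrite eq_sym oner_eq0.
apply: contrapT => /forallNP small.
suff : \sum_k x ord0 k ^+ 2 < 1 by rewrite x1 ltxx.
rewrite (@lt_le_trans _ _ (\sum_(k < n.+1) n.+1%:R^-1))//; last first.
  by rewrite sumr_const card_ord -[leLHS]mulr_natl divff ?pnatr_eq0.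
rewrite ltr_sum//; first by apply/hasP; exists ord0; rewrite ?mem_index_enum.
move=> k _; have /negP := small k; rewrite -ltNge => xk.
rewrite -real_normK ?num_real// (@lt_le_trans _ _ (n.+1%:R^-1 ^+ 2))//.
  by rewrite ltrXn2r.
by rewrite expr2 ler_piMr// invf_le1// ler1n.
Qed.

Lemma unit_sphere_coord_le1 (R : realType) (n : nat) (x : 'rV[R]_n) k :
  unit_sphere n R x -> `|x ord0 k| <= 1.
Proof. by move=> <-; exact: normr_le_euclidean_norm. Qed.

(** Equating the two sums of squares gives
    [(x_j - y_j) * (x_j + y_j) = \sum_k (y_k - x_k) * (y_k + x_k)], where [k]
    ranges over the other indices.  The two coordinates have the same sign and
    are bounded away from zero, hence so is the second factor on the left. *)
Lemma unit_sphere_graph_lipschitz (R : realType) (s : nat)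
    (x y : 'rV[R]_s.+1) (j : 'I_s.+1) (b : bool) (r : R) :
  unit_sphere s.+1 R x -> unit_sphere s.+1 R y ->
  s.+1%:R^-1 <= (-1) ^+ b * x ord0 j -> s.+1%:R^-1 <= (-1) ^+ b * y ord0 j ->
  (forall k, `|x ord0 (lift j k) - y ord0 (lift j k)| <= r) ->
  `|x ord0 j - y ord0 j| <= s.+1%:R * s%:R * r.
Proof.
move=> Sx Sy xj yj xyr.
have -> : `|x ord0 j - y ord0 j| =
    `|(-1) ^+ b * x ord0 j - (-1) ^+ b * y ord0 j|.
  by rewrite -mulrBr normrM normrX normrN1 expr1n mul1r.
set u := _ * _ in xj *; set v := _ * _ in yj *.
have key : `|u - v| * (u + v) <= s%:R * (2 * r).
  have u0 : 0 <= u by apply: le_trans xj; rewrite invr_ge0.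
  have v0 : 0 <= v by apply: le_trans yj; rewrite invr_ge0.
  rewrite -{1}[u + v]ger0_norm ?addr_ge0// -normrM -subr_sqr.
  rewrite /u /v !exprMn -!exprM mulnC exprM sqrrN expr1n expr1n !mul1r.
  have split_j z : unit_sphere s.+1 R z ->
      z ord0 j ^+ 2 + \sum_(k < s) z ord0 (lift j k) ^+ 2 = 1.
    by move=> /unit_sphere_sumsq; rewrite (bigD1_ord j).
  have x1 := split_j x Sx; have y1 := split_j y Sy.
  have -> : x ord0 j ^+ 2 - y ord0 j ^+ 2 =
      \sum_(k < s) (y ord0 (lift j k) ^+ 2 - x ord0 (lift j k) ^+ 2).
    by rewrite sumrB; lra.
  rewrite (le_trans (ler_norm_sum _ _ _))//.
  rewrite mulr_natl -[in leRHS](card_ord s) -sumr_const.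
  apply: ler_sum => k _; rewrite subr_sqr normrM distrC mulrC ler_pM//.
  rewrite (le_trans (ler_normD _ _))//.
  by have := unit_sphere_coord_le1 (lift j k) Sx;
     have := unit_sphere_coord_le1 (lift j k) Sy; lra.
have n0 : 0 < s.+1%:R :> R by rewrite ltr0n.
have : `|u - v| * (2 * s.+1%:R^-1) <= s%:R * (2 * r).
  by apply: le_trans key; rewrite ler_wpM2l// mulr_natl mulr2n lerD.
rewrite [leLHS]mulrA ler_pdivrMr// => le2; rewrite -(ler_pM2r (ltr0Sn R 1)).
by apply: le_trans le2 _; rewrite le_eqVlt; apply/orP; left; apply/eqP; ring.
Qed.

Lemma unit_grid (R : realType) (N : nat) (u : R) : 0 <= u <= N.+1%:R ->
  exists f : 'I_N.+1, f%:R <= u <= f%:R + 1.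
Proof.
elim: N => [|N IHN] /andP[u0 uN]; first by exists ord0; rewrite u0 add0r uN.
have [uN1|Nu] := lerP u N.+1%:R; last first.
  by exists ord_max; rewrite ltW//= natr1.
have [|f fu] := IHN; first by rewrite u0.
by exists (widen_ord (leqnSn _) f).
Qed.

(** The sphere is cut according to a large coordinate, its sign, and the grid
    cell of the remaining coordinates: [2 * s.+1 * N ^ s] pieces of diameter at
    most [C / N], so that the powers of [N] cancel. *)
Lemma hausdorff_measure_sphere_lty (R : realType) (s : nat) :
  (hausdorff_measure s (unit_sphere s.+1 R) < +oo)%E.
Proof.
(* [2 * s.+1 ^ 2 / N] bounds every coordinate of a difference inside one piece;
   the Euclidean norm costs one more factor [s.+1]. *)
pose C : R := s.+1%:R * (s.+1%:R * s.+1%:R * 2).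
have C0 : 0 <= C by rewrite !mulr_ge0.
suff : (hausdorff_measure s (unit_sphere s.+1 R) <=
        (s.+1%:R * 2 * C ^+ s)%:E)%E.
  by move=> /le_lt_trans; apply; rewrite ltry.
apply: ge_ereal_sup => _ [delta /= delta0 <-].
pose M := Num.bound (C / delta); pose N := M.+1.
have N0 : 0 < N%:R :> R by rewrite ltr0n.
have CN : C / N%:R <= delta.
  rewrite ler_pdivrMr// mulrC -ler_pdivrMr//.
  rewrite (le_trans (ltW (archi_boundP _)))//.
    by rewrite divr_ge0// ltW.
  by rewrite ler_nat.
pose U (t : 'I_s.+1 * bool * {ffun 'I_s -> 'I_N}) := [set x : 'rV[R]_s.+1 |
  [/\ unit_sphere s.+1 R x, s.+1%:R^-1 <= (-1) ^+ t.1.2 * x ord0 t.1.1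
    & forall k, (t.2 k)%:R <= (x ord0 (lift t.1.1 k) + 1) * N%:R / 2
                           <= (t.2 k)%:R + 1]].
have -> : s.+1%:R * 2 * C ^+ s =
    #|{: 'I_s.+1 * bool * {ffun 'I_s -> 'I_N}}|%:R * (C / N%:R) ^+ s.
  rewrite !card_prod card_bool card_ffun !card_ord !natrM natrX expr_div_n.
  by field; rewrite expf_neq0// gt_eqF.
apply: (@hausdorff_content_finite_cover _ _ _ _ U) => //.
- move=> x Sx; have [j xj] := unit_sphere_large_coord Sx.
  have /choice[f fP] : forall k, exists f : 'I_N,
      f%:R <= (x ord0 (lift j k) + 1) * N%:R / 2 <= f%:R + 1.
    move=> k; apply: unit_grid.
    have := unit_sphere_coord_le1 (lift j k) Sx.
    rewrite ler_norml => /andP[? ?]; apply/andP; split.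
      by rewrite divr_ge0// mulr_ge0//; lra.
    by rewrite ler_pdivrMr// mulrC ler_wpM2l//; lra.
  exists (j, x ord0 j < 0, [ffun k => f k]) => //; split => //=.
    by rewrite -real_normrEsign ?num_real.
  by move=> k; rewrite ffunE.
- by rewrite divr_ge0.
- move=> [[j b] f]; apply: ge_ereal_sup => _ [x [y [Ux Uy ->]]].
  rewrite lee_fin /C -mulrA; apply: euclidean_norm_le_coord.
  have near k : `|x ord0 (lift j k) - y ord0 (lift j k)| <= 2 / N%:R.
    have [_ _ /(_ k)/=/andP[x1 x2]] := Ux.
    have [_ _ /(_ k)/=/andP[y1 y2]] := Uy.
    by rewrite ler_pdivlMr// -[X in _ * X]gtr0_norm// -normrM ler_norml; lra.
  have N20 : 0 <= 2 / N%:R :> R by rewrite divr_ge0.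
  move=> k; rewrite !mxE -mulrA.
  have [/= Sx xj _] := Ux; have [/= Sy yj _] := Uy.
  case: (unliftP j k) => [i ->|->].
    by rewrite (le_trans (near i))// ler_peMl// -natrM ler1n.
  rewrite (le_trans (unit_sphere_graph_lipschitz Sx Sy xj yj near))//.
  by rewrite ler_wpM2r// ler_wpM2l// ler_nat.
Qed.

(** * Asymptotic values near a direction with negative leading forms *)

Lemma mp_eval_cvg (R : realType) (n : nat) (h : mpoly.mpoly n R) (T : Type)
    (F : set_system T) {FF : Filter F} (f : T -> 'rV[R]_n) (l : 'rV[R]_n) :
  (forall k, f t ord0 k @[t --> F] --> l ord0 k) ->
  mp_eval h (f t) @[t --> F] --> mp_eval h l.
Proof.
move=> fl; rewrite /mp_eval mpoly.mevalE.
under eq_fun do rewrite mpoly.mevalE.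
apply: cvg_big => [|m _]; first exact: add_continuous.
apply: cvgM; first exact: cvg_cst.
apply: cvg_big => [|k _]; first exact: mul_continuous.
exact: continuous_cvg (@exprn_continuous R _ _) (fl k).
Qed.

Lemma asymptotic_index_le_degree (R : realType) (n : nat)
    (h : mpoly.mpoly n R) (d : 'rV[R]_n) :
  (asymptotic_index h d <= mp_degree h)%N.
Proof.
apply/bigmax_leqP => k _.
by rewrite /mp_degree -ltnS (ltn_predK (ltn_ord k)).
Qed.

(** A constant polynomial has asymptotic value zero in every direction. *)
Lemma asymptotic_value_lt0_degree (R : realType) (n : nat)
    (h : mpoly.mpoly n R) (d : 'rV[R]_n) :
  (asymptotic_value h d < 0)%E -> (0 < mp_degree h)%N.
Proof.
rewrite /asymptotic_value; case: posnP => // deg0.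
suff -> : asymptotic_index h d = 0%N by rewrite /= ltxx.
by apply/eqP; rewrite -leqn0 -deg0 asymptotic_index_le_degree.
Qed.

(** Where the leading form does not vanish, the asymptotic index is the degree,
    so the leading form alone decides the sign of the asymptotic value.  The
    degree has to be positive: a negative constant has asymptotic value zero. *)
Lemma asymptotic_value_lt0 (R : realType) (n : nat) (h : mpoly.mpoly n R)
    (d : 'rV[R]_n) : (0 < mp_degree h)%N ->
  mp_eval (mp_hcomp (mp_degree h) h) d < 0 -> (asymptotic_value h d < 0)%E.
Proof.
move=> deg0 phi0; rewrite /asymptotic_value.
have deg_lt : (mp_degree h < mpoly.msize h)%N.
  by move: deg0; rewrite /mp_degree; case: (mpoly.msize h).
have -> : asymptotic_index h d = mp_degree h.
  apply/eqP; rewrite eqn_leq; apply/andP; split.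
    exact: asymptotic_index_le_degree.
  by apply: (@leq_bigmax_cond _ _ _ (Ordinal deg_lt)); rewrite lt_eqF.
rewrite phi0; case: ltnP => [_|deg1]; first exact: ltNy0.
by rewrite eqn_leq deg1 deg0 lte_fin.
Qed.

(** Stated along an arbitrary filter, so that it applies to points of the sphere
    given by a parametrization. *)
Lemma near_Dstar (R : realType) (n m : nat) (g : 'I_m.+1 -> mpoly.mpoly n R)
    (d0 : 'rV[R]_n) (T : Type) (F : set_system T) {FF : Filter F}
    (f : T -> 'rV[R]_n) :
  Dstar g d0 ->
  (forall i, mp_eval (mp_hcomp (mp_degree (g i)) (g i)) d0 < 0) ->
  (\forall t \near F, unit_sphere n R (f t)) ->
  (forall k, f t ord0 k @[t --> F] --> d0 ord0 k) ->
  \forall t \near F, Dstar g (f t).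
Proof.
move=> [_ g_d0] phi_d0 near_sphere f_d0.
have near_phi : \forall t \near F, forall i : 'I_m.+1,
    mp_eval (mp_hcomp (mp_degree (g i)) (g i)) (f t) < 0.
  apply: filter_forall => i.
  exact: (cvgr_lt _ (mp_eval_cvg f_d0)).
apply: filterS2 near_sphere near_phi => t Sft phi_ft; split => // i.
exact: asymptotic_value_lt0 (asymptotic_value_lt0_degree (g_d0 i)) _.
Qed.

(** * Graph charts of the sphere, and the conclusion *)

Lemma cvg_sumsq (R : realType) (s : nat) (T : Type)
    (F : set_system T) {FF : Filter F} (f : T -> 'rV[R]_s) (y0 : 'rV[R]_s) :
  (forall i, f t ord0 i @[t --> F] --> y0 ord0 i) ->
  \sum_i f t ord0 i ^+ 2 @[t --> F] --> \sum_i y0 ord0 i ^+ 2.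
Proof.
move=> fy0; apply: cvg_big => [|i _]; first exact: add_continuous.
exact: continuous_cvg (@exprn_continuous R _ _) (fy0 i).
Qed.

Section SphereChart.
Variables (R : realType) (s : nat) (j : 'I_s.+1) (b : bool).

(** The hemisphere on which coordinate [j] has sign [(-1) ^+ b], as a graph over
    the hyperplane of the other coordinates; [Num.sqrt] truncates to zero outside
    the unit ball. *)
Definition sphere_chart (y : 'rV[R]_s) : 'rV[R]_s.+1 :=
  \row_k if unlift j k is Some i then y ord0 i
         else (-1) ^+ b * Num.sqrt (1 - \sum_i y ord0 i ^+ 2).

Lemma sphere_chart_lift y i : sphere_chart y ord0 (lift j i) = y ord0 i.
Proof. by rewrite mxE liftK. Qed.

Lemma sphere_chart_pole (y : 'rV[R]_s) :
  sphere_chart y ord0 j = (-1) ^+ b * Num.sqrt (1 - \sum_i y ord0 i ^+ 2).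
Proof. by rewrite mxE unlift_none. Qed.

Lemma sphere_chart_on_sphere (y : 'rV[R]_s) : \sum_i y ord0 i ^+ 2 <= 1 ->
  unit_sphere s.+1 R (sphere_chart y).
Proof.
move=> y1; apply/unit_sphere_sumsq; rewrite (bigD1_ord j)//= sphere_chart_pole.
under eq_bigr do rewrite sphere_chart_lift.
rewrite exprMn sqr_sqrtr ?subr_ge0// -exprM mulnC exprM sqrrN.
by rewrite !expr1n mul1r subrK.
Qed.

Lemma near_sphere_chart_on_sphere (T : Type) (F : set_system T)
    {FF : Filter F} (f : T -> 'rV[R]_s) (y0 : 'rV[R]_s) :
  \sum_i y0 ord0 i ^+ 2 < 1 ->
  (forall i, f t ord0 i @[t --> F] --> y0 ord0 i) ->
  \forall t \near F, unit_sphere s.+1 R (sphere_chart (f t)).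
Proof.
move=> y01 /cvg_sumsq/cvgr_lt/(_ _ y01); apply: filterS => t /ltW.
exact: sphere_chart_on_sphere.
Qed.

Lemma sphere_chart_cvg (T : Type) (F : set_system T) {FF : Filter F}
    (f : T -> 'rV[R]_s) (y0 : 'rV[R]_s) :
  (forall i, f t ord0 i @[t --> F] --> y0 ord0 i) ->
  forall k, sphere_chart (f t) ord0 k @[t --> F] --> sphere_chart y0 ord0 k.
Proof.
move=> fy0 k; case: (unliftP j k) => [i ->|->].
  under eq_fun do rewrite sphere_chart_lift.
  by rewrite sphere_chart_lift; apply: fy0.
under eq_fun do rewrite sphere_chart_pole.
rewrite sphere_chart_pole; apply: cvgM; first exact: cvg_cst.
apply: continuous_cvg; first exact: sqrt_continuous.
by apply: cvgB; [exact: cvg_cst|exact: cvg_sumsq].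
Qed.

End SphereChart.

Lemma sphere_chart_surj (R : realType) (s : nat) (j : 'I_s.+1)
    (d : 'rV[R]_s.+1) : unit_sphere s.+1 R d ->
  sphere_chart j (d ord0 j < 0) (\row_i d ord0 (lift j i)) = d.
Proof.
move=> /unit_sphere_sumsq; rewrite (bigD1_ord j)//= => d1.
apply/rowP => k; case: (unliftP j k) => [i ->|->].
  by rewrite sphere_chart_lift mxE.
rewrite sphere_chart_pole; under eq_bigr do rewrite mxE.
by rewrite -{2}d1 addrK sqrtr_sqr -realEsign ?num_real.
Qed.

Theorem theorem4 (R : realType) (n m : nat) (g : 'I_m.+1 -> mpoly.mpoly n R)
    (Dstar_nonempty : Dstar g !=set0)
    (Hd0 : exists2 d0 : 'rV[R]_n, Dstar g d0
         & forall i : 'I_m.+1,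
             mp_eval (mp_hcomp (mp_degree (g i)) (g i)) d0 < 0) :
  (0 < sphere_measure (Dstar g))%E.
Proof.
have [d0 Dd0 phi_d0] := Hd0; clear Dstar_nonempty Hd0.
have [Sd0 _] := Dd0; case: n => [|s] in g d0 Dd0 Sd0 phi_d0 *.
  by have [[]] := unit_sphere_large_coord Sd0.
have [j d0j] := unit_sphere_large_coord Sd0.
pose b := d0 ord0 j < 0.
pose psi : 'rV[R]_s -> 'rV[R]_s.+1 := sphere_chart j b.
pose y0 : 'rV[R]_s := \row_i d0 ord0 (lift j i).
have psi_y0 : psi y0 = d0 by exact: sphere_chart_surj.
have FF : Filter (nbhs y0) by exact: nbhs_filter.
have id_cvg i : (y : 'rV[R]_s) ord0 i @[y --> nbhs y0] --> y0 ord0 i.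
  exact: coord_continuous.
have y01 : \sum_i y0 ord0 i ^+ 2 < 1.
  have /unit_sphere_sumsq := Sd0; rewrite (bigD1_ord j)//= => <-.
  rewrite /y0; under eq_bigr do rewrite mxE.
  by rewrite ltrDr -real_normK ?num_real// exprn_gt0// (lt_le_trans _ d0j)//.
have near_D : nbhs y0 [set y | Dstar g (psi y)].
  apply: (@near_Dstar _ _ _ _ d0 _ _ FF) => //.
    exact: (@near_sphere_chart_on_sphere R s j b _ _ FF id y0).
  by move=> k; rewrite -psi_y0; exact: (@sphere_chart_cvg R s j b _ _ FF id y0).
have /nbhs_ballP[e /= e0 ball_D] := near_D.
have e20 : 0 < e / 2 by rewrite divr_gt0.
have lift_cube (y : 'rV[R]_s) :
    (forall k, `|y ord0 k - y0 ord0 k| <= e / 2) -> Dstar g (psi y).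
  move=> yy0; apply: ball_D; split => // i k.
  by rewrite -ball_normE /= distrC (ord1 i) (le_lt_trans (yy0 k))//; lra.
have measure_gt0 (A : set 'rV[R]_s.+1) : Dstar g `<=` A ->
    (0 < hausdorff_measure s A)%E.
  move=> DA; apply: lt_le_trans (@hausdorff_measure_proj_ge R s s.+1 A (lift j)
      (fun k => y0 ord0 k) (e / 2) e20 _).
    by rewrite lte_fin exprn_gt0.
  move=> y /lift_cube/DA Ay; exists (psi y) => // k.
  by rewrite sphere_chart_lift.
have sphere_gt0 := measure_gt0 (unit_sphere s.+1 R) (fun x Dx => Dx.1).
(* The inverse of [+oo] is zero, whence the need for a finite denominator. *)
rewrite /sphere_measure /= mule_gt0 ?measure_gt0// inve_gt0//.
  by rewrite gt_eqF.
by rewrite lt_eqF// hausdorff_measure_sphere_lty.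
Qed.
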